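(* Let $X$ be a topological space. If $X$ has a regular $G_\delta$-diagonal and $X^2$ has countable weak extent (i.e. $we(X^2)\le\omega$), then $X$ condenses onto a second countable Hausdorff space.
   Context: The diagonal of $X^2$ is $\Delta_X=\{(x,x):x\in X\}$. A space $X$ has a regular $G_\delta$-diagonal if $\Delta_X$ is the intersection of countably many closed neighbourhoods of $\Delta_X$ in $X^2$, i.e. there are open sets $U_n\subseteq X^2$ ($n<\omega$) with $\Delta_X=\bigcap_{n<\omega}U_n=\bigcap_{n<\omega}\overline{U_n}$. For a family $\mathcal{B}$ of subsets of a space $Y$ and $A\subseteq Y$, put $\mathrm{St}(A,\mathcal{B})=\bigcup\{B\in\mathcal{B}:A\cap B\ne\emptyset\}$. The weak extent $we(Y)$ of a space $Y$ is the least cardinal $\kappa$ such that for every open cover $\mathcal{U}$ of $Y$ there is $A\subseteq Y$ with $|A|\le\kappa$ and $\mathrm{St}(A,\mathcal{U})=Y$. $X$ condenses onto $Y$ if there is a continuous bijection from $X$ onto $Y$. *)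

(* Defs.v *)
From mathcomp Require Import all_boot all_classical topology.

Set Implicit Arguments.
Unset Strict Implicit.
Unset Printing Implicit Defensive.

Local Open Scope classical_set_scope.
Local Open Scope card_scope.

Definition regular_Gdelta_diagonal (X : topologicalType) : Prop :=
  exists U : nat -> set (X * X),
    [/\ forall n, open (U n),
        diagonal = \bigcap_n U n
      & diagonal = \bigcap_n closure (U n)].

Definition star (Y : Type) (A : set Y) (B : set (set Y)) : set Y :=
  \bigcup_(V in [set V | B V /\ A `&` V !=set0]) V.

Definition open_set_cover (Y : topologicalType) (B : set (set Y)) : Prop :=
  B `<=` open /\ \bigcup_(V in B) V = [set: Y].

(* The cardinal kappa is represented by a set K of that cardinality, in an
   arbitrary type; "#<=" compares cardinalities. *)
Definition star_bound (Y : topologicalType) (T : Type) (K : set T) : Prop :=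
  forall B : set (set Y), open_set_cover B ->
    exists2 A : set Y, A #<= K & star A B = [set: Y].

Lemma card_min (I : Type) (T : I -> Type) (F : forall i, set (T i)) :
  inhabited I -> exists i, forall j, F i #<= F j.
Proof.
move=> [i0].
pose P (S : set (forall i, T i)) :=
  (forall g, S g -> forall i, F i (g i)) /\
  (forall g h i, S g -> S h -> g i = h i -> g = h).
have [|S [[SF Sinj] Smax]] := @Zorn_bigcup _ P.
  move=> C CP Ctot; split=> [g [S CS Sg] i|g h i [S CS Sg] [S' CS' Sh]].
    exact: (CP _ CS).1.
  have [SS'|S'S] := Ctot _ _ CS CS'.
    exact: (CP _ CS').2 (SS' _ Sg) Sh.
  exact: (CP _ CS).2 Sg (S'S _ Sh).
have [i Si] : exists i, F i `<=` (fun g => g i) @` S.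
  apply: contrapT => /forallNP noti.
  have {}noti i : {x | F i x & ~ ((fun g => g i) @` S) x}.
    by apply/cid2; have /existsNP[x /not_implyP[]] := noti i; exists x.
  pose g i := s2val (noti i).
  have gF i : F i (g i) by rewrite /g; case: (noti i).
  have gS i h : S h -> h i <> g i.
    by move=> Sh hg; move: hg; rewrite /g; case: (noti i) => x /= _ + hx; apply; exists h.
  apply: (Smax (S `|` [set g])); first split; first exact: subsetUl.
    by move=> /(_ g (or_intror erefl)) Sg; exact: (gS i0 g Sg).
  split=> [h [/SF//|->//]|h k i [Sh|->] [Sk|->]] //.
  - exact: Sinj.
  - by move/gS => /(_ Sh).
  - by move/esym/gS => /(_ Sk).
exists i => j.
apply: card_le_trans (subset_card_le Si) _.
apply: card_le_trans (card_image_le _ _) _.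
have /card_eqPle[_ +] : (fun g => g j) @` S #= S.
  by apply: inj_card_eq => g h /set_mem Sg /set_mem Sh; exact: Sinj.
move=> h; apply: card_le_trans h _; apply: subset_card_le => _ [g Sg <-].
exact: SF.
Qed.

Lemma card_total (T U : Type) (A : set T) (B : set U) :
  A #<= B \/ B #<= A.
Proof.
have [[|] h] := @card_min bool (fun b => if b then T else U)
  (fun b => if b return set (if b then T else U) then A else B) (inhabits true).
  by left; exact: h false.
by right; exact: h true.
Qed.

Lemma card_le_subset (T U : Type) (A : set T) (B : set U) :
  A #<= B -> exists C : set U, C #= A.
Proof.
elim/Ppointed: U => U in B *.
  by rewrite emptyE => /eqP ->; exists set0; rewrite card_eq0.
by move=> /pcard_leP[f]; exists (f @` A); exact: card_image.
Qed.

Lemma weak_extent_subproof (Y : topologicalType) :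
  exists K : set Y, star_bound Y K /\
    forall L : set Y, star_bound Y L -> K #<= L.
Proof.
have bT : star_bound Y [set: Y].
  move=> B [_ Bc]; exists [set: Y]; first exact: card_lexx.
  rewrite -subTset => y yY; have [V BV Vy] : (\bigcup_(V in B) V) y by rewrite Bc.
  by exists V => //; split=> //; exists y.
pose I := {K : set Y | star_bound Y K}.
have [[K bK] Kmin] :=
  @card_min I (fun=> Y) (fun K => sval K) (inhabits (exist _ _ bT)).
by exists K; split=> // L bL; exact: (Kmin (exist _ _ bL)).
Qed.

(* we(Y), as a set whose cardinality is the least kappa.  It suffices to look
   for kappa among the cardinalities of subsets of Y, since |Y| has the
   property: see weak_extent_le. *)
Definition weak_extent (Y : topologicalType) : set Y :=
  sval (cid (weak_extent_subproof Y)).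
Arguments weak_extent Y : clear implicits.

Lemma weak_extent_le (Y : topologicalType) (T : Type) (K : set T) :
  weak_extent Y #<= K <-> star_bound Y K.
Proof.
rewrite /weak_extent; case: cid => W /= [bW Wmin]; split.
  move=> WK B /bW[A AW AB]; exists A => //; exact: card_le_trans WK.
move=> bK.
have [//|KW] := card_total W K.
have [L /card_eqPle[LK KL]] := card_le_subset KW.
apply: card_le_trans LK; apply: Wmin => B /bK[A AK AB].
by exists A => //; exact: card_le_trans KL.
Qed.

Definition condenses_onto (X Y : topologicalType) : Prop :=
  exists f : X -> Y, continuous f /\ bijective f.

(* Main.v *)
From HB Require Import structures.
Require Import Defs.
From mathcomp Require Import all_boot all_classical topology.

Local Open Scope classical_set_scope.

(**
Let the open sets U_n witness the regular G_delta-diagonal. For each k, cover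
X^2 by U_k together with the boxes V x W such that, for some n, V x V lies in
U_n while V x W misses U_n; countable weak extent yields a countable set A_k
whose star in this cover is X^2. If x <> y, then (x, y) is outside some U_k, so
it lies in a box V x W that meets A_k in a point (a, b). As a is in V, the
section U_n[a] = {z | (a, z) in U_n} contains x and misses W, so y is off its
closure. Hence the countable family of all sets U_n[a] and X \ cl(U_n[a]), with
a a first coordinate of a point of some A_k, separates points, and it generates
the coarser topology sought.
*)

(** The phantom argument [D] lets the topology attached to the carrier [T] depend on the family,
    which serves as its subbase. *)
Definition generated_space (T : Type) (D : set (set T)) : Type := T.

HB.instance Definition _ (T : choiceType) (D : set (set T)) :=
  Choice.on (generated_space T D).
HB.instance Definition _ (T : choiceType) (D : set (set T)) :=
  isSubBaseTopological.Build (generated_space T D) D id.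

Lemma open_generated_space (T : choiceType) (D : set (set T)) (A : set T) :
  @open (generated_space T D) A <->
  exists2 C, C `<=` finI_from D id & \bigcup_(B in C) B = A.
Proof. by split => -[C CD <-]; exists C. Qed.

Lemma finI_from_open_generated_space (T : choiceType) (D : set (set T)) :
  finI_from D id `<=` @open (generated_space T D).
Proof.
move=> A DA; apply/open_generated_space.
by exists [set A]; [move=> _ -> | rewrite bigcup_set1].
Qed.

Lemma subbase_open_generated_space (T : choiceType) (D : set (set T)) :
  D `<=` @open (generated_space T D).
Proof.
by move=> A DA; apply: finI_from_open_generated_space; exact: (finI_from1 id).
Qed.

Lemma second_countable_generated_space (T : choiceType) (D : set (set T)) :
  countable D -> @second_countable (generated_space T D).
Proof.
move=> cD; exists (finI_from D id); first exact: finI_from_countable.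
split=> [|x A]; first exact: finI_from_open_generated_space.
rewrite nbhsE => -[B [/open_generated_space[C CD <-] [E CE Ex]] CA].
exists E; first by split => //; exact: CD.
by move=> y Ey; apply: CA; exists E.
Qed.

Lemma continuous_generated_space (X : topologicalType) (D : set (set X)) :
  D `<=` open -> continuous (id : X -> generated_space X D).
Proof.
move=> Dopen; apply/continuousP => _ /open_generated_space[C CD <-].
rewrite preimage_id; apply: bigcup_open => A /CD[F FD <-].
rewrite openE => x Fx; apply: filter_bigI => B FB.
by apply: open_nbhs_nbhs; split; [apply/Dopen/set_mem/FD | exact: Fx].
Qed.

Lemma hausdorff_generated_space (T : choiceType) (D : set (set T)) :
  (forall x y, x <> y ->
    exists A B, [/\ D A, D B, A x, B y & A `&` B = set0]) ->
  hausdorff_space (generated_space T D).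
Proof.
move=> Dsep; rewrite open_hausdorff => x y /eqP xy.
have [A [B [DA DB Ax By AB0]]] := Dsep x y xy.
exists (A, B); first by split; apply/mem_set.
by split; [exact: subbase_open_generated_space.. | exact/eqP].
Qed.

Lemma open_xsection (X Y : topologicalType) (U : set (X * Y)) (a : X) :
  open U -> open (xsection U a).
Proof.
move=> Uopen; rewrite xsectionE.
apply: open_comp Uopen => z _.
exact: (cvg_pair (cvg_cst a) (@cvg_id _ (nbhs z))).
Qed.

Lemma open_setX (X Y : topologicalType) (V : set X) (W : set Y) :
  open V -> open W -> open (V `*` W).
Proof.
move=> Vopen Wopen; rewrite openE => -[x y] [/= Vx Wy].
by exists (V, W) => //; split; apply: open_nbhs_nbhs.
Qed.

(** A neighbourhood in the product only contains a box of neighbourhoods; passing to interiors makes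
    its sides open. *)
Lemma notin_closure_setX (X Y : topologicalType) (U : set (X * Y)) x y :
  ~ closure U (x, y) -> exists V W,
    [/\ open_nbhs x V, open_nbhs y W & V `*` W `&` U = set0].
Proof.
move=> /existsNP[B /not_implyP[[[V W] /= [xV yW] VWB] /nonemptyPn UB0]].
exists (interior V), (interior W); split.
- by split; [exact: open_interior | exact: nbhs_singleton (nbhs_interior xV)].
- by split; [exact: open_interior | exact: nbhs_singleton (nbhs_interior yW)].
- rewrite -subset0 -UB0 => -[u v] [[/= Vu Wv] Uuv]; split=> //.
  by apply: VWB; split; exact: interior_subset.
Qed.

Definition diagonal_cover (X : topologicalType) (U : nat -> set (X * X))
    (k : nat) : set (set (X * X)) :=
  [set B | B = U k \/ exists V W n, [/\ open V, open W, V `*` V `<=` U n,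
                                    V `*` W `&` U n = set0 & B = V `*` W]].

(** [U k] takes care of the diagonal. A point [(x, y)] off it avoids the closure of some [U n],
    hence has a box missing [U n]; shrinking the first side around [x] puts its square inside
    [U n]. *)
Lemma diagonal_cover_open_set_cover (X : topologicalType)
    (U : nat -> set (X * X)) (k : nat) :
  (forall n, open (U n)) -> diagonal = \bigcap_n U n ->
  diagonal = \bigcap_n closure (U n) -> open_set_cover (diagonal_cover X U k).
Proof.
move=> Uopen UE clUE.
have Uxx n x : U n (x, x).
  by have : diagonal (x, x) by []; rewrite UE; exact.
split=> [_ [->|[V [W [n [Vo Wo _ _ ->]]]]]|]; [exact: Uopen|exact: open_setX|].
rewrite -subTset => -[x y] _.
have [<-|xy] := pselect (x = y); first by exists (U k) => //; left.
have : ~ (\bigcap_n closure (U n)) (x, y) by rewrite -clUE.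
move=> /existsNP[n /not_implyP[_]].
move=> /notin_closure_setX[V [W [[Vo Vx] [Wo Wy] VW0]]].
have [[P Q] /= [xP xQ] PQU] : nbhs (x, x) (U n).
  by apply: open_nbhs_nbhs; split; [exact: Uopen | exact: Uxx].
(* Meeting both [P] and [Q] makes the square of [V'] fit into the box [P]*[Q] around [(x, x)]. *)
pose V' := V `&` interior (P `&` Q).
have V'V : V' `<=` V by exact: subIsetl.
exists (V' `*` W).
  right; exists V', W, n; split=> //.
  - by apply: openI => //; exact: open_interior.
  - move=> [u v] [/= [_ /interior_subset[Pu _]] [_ /interior_subset[_ Qv]]].
    exact: PQU.
  - by rewrite -subset0 -VW0 => -[u v] [[/= /V'V Vu Wv] Uuv].
split=> //=; split=> //.
by apply: nbhs_singleton; apply: nbhs_interior; exact: filterI.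
Qed.

Lemma open_set0_closure (X : topologicalType) (A W : set X) :
  open W -> W `&` A = set0 -> W `<=` ~` closure A.
Proof.
move=> Wo WA0 y Wy clAy.
have [|z [Az Wz]] := clAy W; first exact: open_nbhs_nbhs.
by rewrite -[False]/(set0 z) -WA0.
Qed.

Theorem corollary3p6 (X : topologicalType)
  (Xdiag : regular_Gdelta_diagonal X)
  (Xext : countable (weak_extent (X * X)%type)) :
  exists Y : topologicalType,
    [/\ condenses_onto X Y, @second_countable Y & hausdorff_space Y].
Proof.
have [U [Uopen UE clUE]] := Xdiag.
have {}Xext := (weak_extent_le _ _).1 Xext.
have /choice[A Astar] k :
    exists A, countable A /\ star A (diagonal_cover X U k) = setT.
  have [A cA AT] := Xext _ (diagonal_cover_open_set_cover X U k Uopen UE clUE).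
  by exists A.
pose E := fst @` \bigcup_k A k.
have cE : countable E.
  apply: card_le_trans (card_image_le _ _) _; apply: bigcup_countable => // k _.
  by have [] := Astar k.
pose section (p : nat * X) := xsection (U p.1) p.2.
(* All indices are paired with all points of [E]: the [n] of a box is not tied to the [k] whose
   [A k] supplies [a]. *)
pose I : set (nat * X) := setT `*` E.
pose D := \bigcup_(p in I) [set section p; ~` closure (section p)].
have cI : countable I by exact: countableX.
exists (generated_space X D); split.
- exists id; split; last by exists id.
  apply: continuous_generated_space => _ [p _ [->|->]].
    exact: open_xsection.
  by rewrite openC; exact: closed_closure.
- apply: second_countable_generated_space.
  apply: bigcup_countable cI _ => p _.
  exact/finite_set_countable/finite_set2.
- apply: hausdorff_generated_space => x y xy.
  have : ~ (\bigcap_n U n) (x, y) by rewrite -UE.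
  move=> /existsNP[k /not_implyP[_ nUk]].
  have : star (A k) (diagonal_cover X U k) (x, y) by rewrite (Astar k).2.
  (* The member containing [(x, y)] cannot be [U k], by the choice of [k], so it is a box. *)
  move=> [_ [[->//|[V [W [n [Vo Wo VVU VWU0 ->]]]]]]].
  move=> [[a b] [Aab [/= Va Wb]]] [/= Vx Wy].
  have Ina : I (n, a) by split=> //; exists (a, b) => //; exists k.
  exists (section (n, a)), (~` closure (section (n, a))); split.
  + by exists (n, a) => //; left.
  + by exists (n, a) => //; right.
  + by apply/xsectionP; exact: VVU.
  (* Since [a] is in [V], a point [z] of [W] in the section would put [(a, z)] in both [V]*[W] and
     [U n]. *)
  + apply: open_set0_closure Wy => //; rewrite -subset0 => z [Wz /xsectionP Uaz].
    by have : set0 (a, z) by rewrite -VWU0.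
  + by rewrite -subset0 => z [Sz]; apply; exact: subset_closure.
Qed.
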